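(* Let $\rho\in(0,1)$ and, for each $n$, let $(X_1,\ldots,X_n)$ be jointly normal with $X_i\sim\mathcal N(\mu_i,1)$, $\mu_i\ge0$, and $\operatorname{Corr}(X_i,X_j)=\rho$ for all $i\neq j$. Suppose $\sup_i\mu_i$ is finite. Then, for any $\alpha\in(0,1/2)$, $AnyPwr_{Hochberg}$ goes to zero as $n\to\infty$.
   Context: Testing problem: test $H_{0i}:\mu_i=0$ against $H_{1i}:\mu_i>0$, $1\le i\le n$ (so always $\mu_i\ge0$). The p-values are $P_i=1-\Phi(X_i)$, with $\Phi$ the standard normal distribution function, and $P_{(1)}\le\cdots\le P_{(n)}$ are the ordered p-values, with corresponding null hypotheses $H_{(1)},\ldots,H_{(n)}$. Hochberg's procedure at level $\alpha$ is the step-up procedure with cutoffs $u_i=\alpha/(n-i+1)$: it rejects $H_{(1)},\ldots,H_{(m)}$ where $m=\max\{i:P_{(i)}\le u_i\}$, and rejects nothing if no such $i$ exists. For a multiple testing procedure $T$, $AnyPwr_T=\mathbb P(S_n(T)\ge1)$, where $S_n(T)$ is the number of true positives of $T$, i.e. the number of rejected hypotheses $H_{0i}$, $1\le i\le n$, with $\mu_i>0$. *)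

(* Defs.v *)
From HB Require Import structures.
From mathcomp Require Import all_boot all_order all_algebra.
From mathcomp Require Import all_classical all_reals all_analysis.

Set Implicit Arguments.
Unset Strict Implicit.
Unset Printing Implicit Defensive.

Import Order.TTheory GRing.Theory Num.Theory.
Import numFieldNormedType.Exports.

Local Open Scope classical_set_scope.
Local Open Scope ring_scope.

(* [s] is the standard deviation.  The degenerate law is treated separately,
   because [normal_prob m 0] is by convention the uniform law on [0, 1]. *)
Definition normal_law (R : realType) (m s : R) (B : set R) : \bar R :=
  if s == 0 then dirac m B else normal_prob m s B.

Definition has_normal_law d (T : measurableType d) (R : realType)
    (P : probability T R) (Y : T -> R) (m s : R) : Prop :=
  forall B : set R, measurable B -> P (Y @^-1` B) = normal_law m s B.

(* Joint normality: every linear combination is (possibly degenerate) normal. *)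
Definition jointly_normal d (T : measurableType d) (R : realType)
    (P : probability T R) (n : nat) (X : 'I_n -> {RV P >-> R}) : Prop :=
  forall a : 'I_n -> R, exists m s : R,
    0 <= s /\ has_normal_law P (fun w => \sum_(i < n) a i * X i w) m s.

Definition correlation d (T : measurableType d) (R : realType)
    (P : probability T R) (X Y : {RV P >-> R}) : R :=
  fine (covariance P X Y) /
    (Num.sqrt (fine 'V_P[X]) * Num.sqrt (fine 'V_P[Y])).

Definition Phi (R : realType) (x : R) : R := fine (normal_prob 0 1 `]-oo, x]).

Definition pvalues d (T : measurableType d) (R : realType)
    (P : probability T R) (n : nat) (X : 'I_n -> {RV P >-> R}) (w : T)
    (i : 'I_n) : R := 1 - Phi (X i w).

(* Hypotheses listed by nondecreasing p-value, ties broken by index. *)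
Definition ordering (R : realType) (n : nat) (p : 'I_n -> R) : seq 'I_n :=
  sort (fun i j => p i <= p j) (enum 'I_n).

(* [ordered_pvalue p k] is P_(k), for 1 <= k <= n. *)
Definition ordered_pvalue (R : realType) (n : nat) (p : 'I_n -> R) (k : nat)
    : R := nth 0 [seq p i | i <- ordering p] k.-1.

(* The bound variable of the maximum ranges over 1, ..., n; the maximum of the
   empty family is 0, so that nothing is rejected in that case. *)
Definition step_up (R : realType) (u : nat -> R) (n : nat) (p : 'I_n -> R)
    : {set 'I_n} :=
  let m := (\max_(1 <= k < n.+1 | (ordered_pvalue p k <= u k)%R) k)%N in
  [set i in take m (ordering p)]%SET.

Definition hochberg (R : realType) (alpha : R) (n : nat) (p : 'I_n -> R)
    : {set 'I_n} := step_up (fun k => alpha / (n - k + 1)%N%:R) p.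

Definition true_positives (R : realType) (n : nat) (mu : 'I_n -> R)
    (rejected : {set 'I_n}) : nat := #|[set i in rejected | 0 < mu i]%SET|.

(* A testing procedure maps a vector of p-values to the set of rejected
   hypotheses. *)
Definition any_power d (T : measurableType d) (R : realType)
    (P : probability T R) (n : nat) (X : 'I_n -> {RV P >-> R})
    (mu : 'I_n -> R) (proc : ('I_n -> R) -> {set 'I_n}) : \bar R :=
  P [set w | (1 <= true_positives mu (proc (pvalues X w)))%N].

(* Main.v *)
(* Write [U_i = X_i - mu_i], let [U] be the average of the [U_i] and
   [Y_i = U_i - U].  All Gaussian information is extracted from exponential
   moments of linear combinations, which joint normality gives in closed form;
   neither a common-factor representation nor independence is needed.

   A rejection provides [j] in [1, n] with fewer than [j] p-values above
   [alpha / j].  With [U < K], an event of probability at least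
   [1 - expR (1 - K)], there are three cases.
   - [j >= n / 2]: some p-value is below [2 alpha / n], hence some [Y_i] exceeds
     the [2 alpha / n] quantile of N(0, 1) up to a constant; since
     [Var Y_i <= 1 - rho < 1] a union bound makes this negligible.
   - [J <= j < n / 2]: more than half of the p-values are below [alpha / J],
     which is rare for large [J] by Markov's inequality.
   - [j < J]: all but a bounded number of the [Y_i] are bounded below by some
     [- b].  But the [Y_i] are negatively correlated, so the average of
     [expR (- s * Y_i)] concentrates around its mean, which exceeds
     [expR (s * b)] when [s] is large; the few exceptional terms are controlled
     by the average of [expR (- 2 * s * Y_i)]. *)
Require Import Defs.
From HB Require Import structures.
From mathcomp Require Import all_boot all_order all_algebra.
From mathcomp Require Import all_classical all_reals all_analysis.
From mathcomp Require Import measurable_realfun zify ring lra.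

Set Implicit Arguments.
Unset Strict Implicit.
Unset Printing Implicit Defensive.

Import Order.TTheory GRing.Theory Num.Theory.
Import numFieldNormedType.Exports.

Local Open Scope classical_set_scope.
Local Open Scope ring_scope.

(** * Integrals against normal laws *)

(** The explicit density and the Radon-Nikodym derivative have the same integral over every
    measurable set, so they agree almost everywhere. *)
Lemma ge0_integral_normal_prob (R : realType) (m s : R) (g : R -> R) :
  measurable_fun setT g -> (forall x, 0 <= g x) ->
  (\int[normal_prob m s]_x (g x)%:E =
   \int[lebesgue_measure]_x (g x * normal_pdf m s x)%:E)%E.
Proof.
move=> mg g0; have dom := normal_prob_dominates m s.
under [RHS]eq_integral do rewrite EFinM.
have mf : measurable_fun setT (EFin \o g) by exact/measurable_EFinP.
have f0 x : (0 <= (EFin \o g) x)%E by rewrite lee_fin.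
rewrite -(Radon_Nikodym_SigmaFinite.change_of_variables dom f0)//.
have iRN := Radon_Nikodym_SigmaFinite.f_integrable dom.
apply: ae_eq_integral => //.
- by apply: emeasurable_funM => //; exact: (measurable_int _ iRN).
- apply: emeasurable_funM => //; apply/measurable_EFinP.
  exact: measurable_normal_pdf.
- apply: ae_eqe_mul2l; apply: integral_ae_eq => //.
  + by apply/measurable_EFinP; exact: measurable_normal_pdf.
  + by move=> E _ mE; rewrite -Radon_Nikodym_SigmaFinite.f_integral.
Qed.

Lemma integral_normal_affine (R : realType) (m s : R) (g : R -> R) :
  0 < s -> continuous g -> (forall x, 0 <= g x) ->
  (\int[lebesgue_measure]_x (g x * normal_pdf m s x)%:E =
   \int[lebesgue_measure]_x (g (m + s * x)%R * normal_pdf 0 1 x)%:E)%E.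
Proof.
move=> s0 cg g0; pose F (x : R^o) : R^o := m + s * x.
have dF (x : R^o) : is_derive x (1 : R^o) F s.
  by rewrite /F; apply: is_derive_eq; rewrite add0r mul1r /GRing.scale/= mulr1.
have F'E : F^`()%classic = cst s.
  by apply/funext => x; rewrite derive1E; apply: derive_val.
rewrite (@increasing_ge0_integration_by_substitutionT R F
  (fun x => g x * normal_pdf m s x)); first last.
- by move=> x; rewrite mulr_ge0 ?normal_pdf_ge0.
- move=> x; apply: cvgM; [exact: cg|].
  by apply: continuous_normal_pdf; rewrite gt_eqF.
- apply/cvgryPge => A.
  apply: (filterS _ (nbhs_pinfty_ge (num_real ((A - m) / s)))).
  by move=> x; rewrite /= ler_pdivrMr// mulrC lerBlDl.
- apply/cvgrNyPle => A.
  apply: (filterS _ (nbhs_ninfty_le (num_real ((A - m) / s)))).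
  by move=> x; rewrite /= ler_pdivlMr// mulrC lerBrDl.
- by move=> x; case: (dF x).
- by rewrite F'E; exact: is_cvg_cst.
- by rewrite F'E; exact: is_cvg_cst.
- by rewrite F'E => x; exact: cvg_cst.
- by move=> x y xy; rewrite /F ltrD2l ltr_pM2l.
apply: eq_integral => x _; rewrite F'E /F; congr EFin.
rewrite !fctE /= -mulrA; congr (_ * _).
rewrite !normal_pdfE ?gt_eqF ?oner_eq0// /normal_peak /normal_fun.
rewrite -mulrAC; congr (_ * _); last first.
  congr expR; rewrite addrAC subrr add0r subr0 expr1n exprMn.
  by field; rewrite gt_eqF.
rewrite expr1n mul1r -mulrnAr sqrtrM ?sqr_ge0// sqrtr_sqr gtr0_norm//.
by rewrite invfM mulrAC mulVf ?mul1r// gt_eqF.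
Qed.

(** Integrating against the standard density makes the formula valid for [s = 0] too, where the
    integrand reduces to [g m] times a density of total mass 1. Later lemmas thus rarely split off
    the degenerate law. *)
Lemma ge0_integral_normal_law d (T : measurableType d) (R : realType)
    (P : probability T R) (Y : T -> R) (m s : R) (g : R -> R) :
  measurable_fun setT Y -> 0 <= s -> has_normal_law P Y m s ->
  continuous g -> (forall x, 0 <= g x) ->
  (\int[P]_w (g (Y w))%:E =
   \int[lebesgue_measure]_x (g (m + s * x)%R * normal_pdf 0 1 x)%:E)%E.
Proof.
move=> mY s0 lawY cg g0.
have mg : measurable_fun setT g by exact: continuous_measurable_fun.
have mY' : measurable_fun setT (Y : T -> measurableTypeR R) by [].
pose mYY := isMeasurableFun.Build _ _ _ _ _ mY'.
pose Y' : {mfun T >-> measurableTypeR R} :=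
  HB.pack (Y : T -> measurableTypeR R) mYY.
transitivity (\int[distribution P Y']_x (g x)%:E)%E.
  by rewrite ge0_integral_distribution//=; exact/measurable_EFinP.
move: s0; rewrite le_eqVlt => /predU1P[s0|s0]; last first.
  rewrite -integral_normal_affine//.
  transitivity (\int[normal_prob m s]_x (g x)%:E)%E.
    apply: eq_measure_integral => A mA _; have := lawY A mA.
    by rewrite /normal_law gt_eqF.
  exact: ge0_integral_normal_prob.
transitivity (\int[\d_ (m : measurableTypeR R)]_x (g x)%:E)%E.
  apply: eq_measure_integral => A mA _; have := lawY A mA.
  by rewrite /normal_law -s0 eqxx.
rewrite integral_dirac//=; last exact/measurable_EFinP.
rewrite diracT mul1e.
transitivity (\int[lebesgue_measure]_x ((g m)%:E * (normal_pdf 0 1 x)%:E))%E;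
  last by apply: eq_integral => x _; rewrite -s0 mul0r addr0.
rewrite ge0_integralZl//= ?integral_normal_pdf ?mule1//.
- by apply/measurable_EFinP; exact: measurable_normal_pdf.
- by move=> x _; rewrite lee_fin normal_pdf_ge0.
- by rewrite lee_fin.
Qed.

(** * Real-valued means *)

(** Bundling integrability with a real value lets means be added and compared in [R], without
    finiteness side conditions. *)
Definition has_mean d (T : measurableType d) (R : realType)
    (P : probability T R) (f : T -> R) (v : R) : Prop :=
  P.-integrable setT (EFin \o f) /\ (\int[P]_w (f w)%:E = v%:E)%E.

Section has_mean_theory.
Context d (T : measurableType d) (R : realType) (P : probability T R).
Implicit Types (f g : T -> R) (v c : R).

Lemma has_mean_cst c : has_mean P (cst c) c.
Proof.
split; first exact: finite_measure_integrable_cst.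
by have := expectation_cst P c; rewrite unlock.
Qed.

Lemma has_meanD f g v c :
  has_mean P f v -> has_mean P g c -> has_mean P (fun w => f w + g w) (v + c).
Proof.
move=> [fi fv] [gi gv]; split; first exact: (integrableD measurableT fi gi).
by have := integralD_EFin measurableT fi gi; rewrite fv gv.
Qed.

Lemma has_meanZ c f v : has_mean P f v -> has_mean P (fun w => c * f w) (c * v).
Proof.
move=> [fi fv]; split; first exact: (integrableZl measurableT c fi).
by under eq_integral do rewrite EFinM; rewrite integralZl// fv.
Qed.

Lemma has_mean_sum (I : finType) (f : I -> T -> R) (v : I -> R) :
  (forall i, has_mean P (f i) (v i)) ->
  has_mean P (fun w => \sum_i f i w) (\sum_i v i).
Proof.
move=> fv; have sumD s : has_mean P (fun w => \sum_(i <- s) f i w)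
    (\sum_(i <- s) v i).
  elim: s => [|i s IH].
    rewrite big_nil; under [fun w => _]funext do rewrite big_nil.
    exact: has_mean_cst.
  rewrite big_cons; under [fun w => _]funext do rewrite big_cons.
  exact: has_meanD.
exact: sumD.
Qed.

Lemma has_mean_le f g v c : has_mean P f v -> has_mean P g c ->
  (forall w, f w <= g w) -> v <= c.
Proof.
move=> [fi fv] [gi gv] fg; rewrite -lee_fin -fv -gv.
by apply: le_integral => // w _; rewrite lee_fin.
Qed.

Lemma has_mean_unique f v c : has_mean P f v -> has_mean P f c -> v = c.
Proof. by move=> [_ fv] [_ fc]; apply: EFin_inj; rewrite -fv. Qed.

Lemma has_mean_dominated f g v : measurable_fun setT f -> has_mean P g v ->
  (forall w, `|f w| <= g w) -> exists c, has_mean P f c.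
Proof.
move=> mf [gi _] fg; have fi : P.-integrable setT (EFin \o f).
  apply: (le_integrable measurableT _ _ gi); first exact/measurable_EFinP.
  by move=> w _ /=; rewrite lee_fin (le_trans (fg w))// ler_norm.
exists (fine (\int[P]_w (f w)%:E)); split=> //.
by rewrite fineK//; exact: integrable_fin_num.
Qed.

(** Markov's inequality: [f] dominates the indicator of [A]. *)
Lemma probability_le_mean (A : set T) f v : measurable A -> has_mean P f v ->
  (forall w, 0 <= f w) -> (forall w, A w -> 1 <= f w) -> (P A <= v%:E)%E.
Proof.
move=> mA [fi <-] f0 f1; rewrite -(setIT A) -(integral_indic _ measurableT)//.
apply: ge0_le_integral => //.
- exact/measurable_EFinP.
- exact: measurable_int fi.
- move=> w _; rewrite lee_fin indicE; case: (boolP (w \in A)) => [|_].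
    by rewrite inE => /f1.
  exact: f0.
Qed.

End has_mean_theory.

(** * Moments of a normal variable *)

(** Makes squares integrable by domination, since normal exponential moments are explicit. *)
Lemma sqr_le_expR (R : realType) (x : R) : x ^+ 2 <= 4 * (expR x + expR (- x)).
Proof.
wlog x0 : x / 0 <= x.
  move=> H; have [/H//|x0] := leP 0 x.
  by have := H (- x); rewrite oppr_ge0 (ltW x0) sqrrN opprK addrC; apply.
have e2 : 1 + x / 2 <= expR (x / 2) by exact: expR_ge1Dx.
have -> : expR x = expR (x / 2) * expR (x / 2).
  by rewrite -expRD; congr expR; field.
have := expR_gt0 (- x).
by nra.
Qed.

(** The right side is 1 + O(l^2) near 0, so a nonzero slope [c] would be violated at a small [l] of
    the same sign. The test point is [l = e * c], with [e] small enough that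
    [e * (b + b * c ^+ 2) < 1]. *)
Lemma eq0_of_expR_bound (R : realType) (b c : R) : 0 <= b ->
  (forall l, 1 + l * c <= expR (l ^+ 2 * b)) -> c = 0.
Proof.
move=> b0 H; apply/eqP; apply: contraT => c0.
have c2 : 0 < c ^+ 2 by rewrite exprn_even_gt0.
pose D := 1 + b + b * c ^+ 2.
have D1 : 1 <= D by rewrite /D; nra.
pose e := D^-1.
have eD : e * D = 1 by rewrite mulVf// gt_eqF// (lt_le_trans ltr01).
have e0 : 0 < e by rewrite invr_gt0 (lt_le_trans ltr01).
have e1 : e <= 1 by rewrite invf_le1// (lt_le_trans ltr01).
have := H (e * c).
set u := (e * c) ^+ 2 * b => Hu.
have u1 := expR_ge1Dx (- u).
have uu : expR u * expR (- u) = 1 by rewrite -expRD subrr expR0.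
have eu := expR_gt0 u; have enu := expR_gt0 (- u).
have u0 : 0 <= u by rewrite mulr_ge0// sqr_ge0.
have uE : u = e * (e * c ^+ 2 * b) by rewrite /u exprMn; ring.
have k1 : (1 + e * c * c) * expR (- u) <= 1.
  by move: Hu; rewrite -(ler_pM2r enu) uu.
have k2 : (1 + e * c * c) * (1 - u) <= 1.
  apply: le_trans k1; rewrite ler_pM2l// -mulrA -expr2.
  by rewrite addr_gt0// mulr_gt0.
have k3 : e * b + e * (b * c ^+ 2) < 1 by rewrite -eD /D; nra.
have k4 : e * c ^+ 2 <= e * c ^+ 2 * (e * b + e * (e * b * c ^+ 2)).
  by move: k2; rewrite uE; nra.
have k5 : e * (e * b * c ^+ 2) <= e * (b * c ^+ 2).
  by rewrite ler_pM2l// -mulrA ler_piMl// mulr_ge0// ltW.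
have : e * c ^+ 2 * (e * b + e * (e * b * c ^+ 2)) < e * c ^+ 2.
  by rewrite gtr_pMr ?(mulr_gt0 e0 c2)//; apply: le_lt_trans k3; rewrite lerD2l.
by move=> /(le_lt_trans k4); rewrite ltxx.
Qed.

Section normal_moments.
Context d (T : measurableType d) (R : realType) (P : probability T R).

Lemma has_mean_expR_normal (Y : T -> R) (m s l : R) :
  measurable_fun setT Y -> 0 <= s -> has_normal_law P Y m s ->
  has_mean P (fun w => expR (l * Y w)) (expR (l * m + (l * s) ^+ 2 / 2)).
Proof.
move=> mY s0 lawY.
have cg : continuous (fun y : R => expR (l * y)).
  move=> x; apply: (@continuous_comp _ _ _ ( *%R l) expR).
    exact: mulrl_continuous.
  exact: continuous_expR.
have E : (\int[P]_w (expR (l * Y w))%:E =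
    (expR (l * m + (l * s) ^+ 2 / 2))%:E)%E.
  rewrite (ge0_integral_normal_law mY s0 lawY cg); last first.
    by move=> x; exact: expR_ge0.
  (* Completing the square turns the tilted standard density into a constant times the density of
     N(l s, 1). *)
  transitivity (\int[lebesgue_measure]_x ((expR (l * m + (l * s) ^+ 2 / 2))%:E *
    (normal_pdf (l * s) 1 x)%:E))%E.
    apply: eq_integral => x _; rewrite -EFinM; congr EFin.
    rewrite !normal_pdfE ?oner_eq0// mulrCA [RHS]mulrCA; congr (_ * _).
    rewrite /normal_fun -!expRD; congr expR; rewrite expr1n subr0.
    by field.
  rewrite ge0_integralZl//= ?integral_normal_pdf ?mule1//.
  - by apply/measurable_EFinP; exact: measurable_normal_pdf.
  - by move=> x _; rewrite lee_fin normal_pdf_ge0.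
split=> //; apply/integrableP; split.
  apply/measurable_EFinP; apply: measurableT_comp => //.
  exact: measurable_funM.
under eq_integral do rewrite /= ger0_norm ?expR_ge0//.
by rewrite E ltry.
Qed.

Lemma has_mean_expR_normal_centered (Y : T -> R) (m s l : R) :
  measurable_fun setT Y -> 0 <= s -> has_normal_law P Y m s ->
  has_mean P (fun w => expR (l * (Y w - m))) (expR ((l * s) ^+ 2 / 2)).
Proof.
move=> mY s0 lawY.
have := has_meanZ (expR (- (l * m))) (has_mean_expR_normal l mY s0 lawY).
rewrite -expRD addrA addNr add0r.
by under [fun w => _ * _]funext do rewrite -expRD addrC -mulrBr.
Qed.

Lemma has_mean_sqr_exp (Y : T -> R) (m s : R) :
  measurable_fun setT Y -> 0 <= s -> has_normal_law P Y m s ->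
  exists c, has_mean P (fun w => 4 * (expR (Y w - m) + expR (- (Y w - m)))) c.
Proof.
move=> mY s0 lawY; eexists; apply: has_meanZ; apply: has_meanD.
  have := has_mean_expR_normal_centered 1 mY s0 lawY.
  by under [fun w => _]funext do rewrite mul1r; apply.
have := has_mean_expR_normal_centered (-1) mY s0 lawY.
by under [fun w => _]funext do rewrite mulN1r; apply.
Qed.

Lemma has_mean_normal (Y : T -> R) (m s : R) :
  measurable_fun setT Y -> 0 <= s -> has_normal_law P Y m s -> has_mean P Y m.
Proof.
move=> mY s0 lawY; have [c Hc] := has_mean_sqr_exp mY s0 lawY.
have [k Hk] : exists k, has_mean P (fun w => Y w - m) k.
  apply: (has_mean_dominated _ (has_meanD (has_mean_cst P 1) Hc)) => [|w].
    exact: measurable_funB.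
  have := sqr_le_expR (Y w - m); set y := Y w - m.
  by rewrite ler_norml /cst; nra.
suff k0 : k = 0.
  have := has_meanD Hk (has_mean_cst P m); rewrite k0 add0r.
  by under [fun w => _]funext do rewrite /cst subrK.
(* The exponential moments of [Y - m] dominate [1 + l * k] for every [l], so
   the affine function [1 + l * k] of [l] has slope 0. *)
apply: (@eq0_of_expR_bound R (s ^+ 2 / 2)); first by rewrite divr_ge0// sqr_ge0.
move=> l; rewrite mulrA -exprMn.
apply: (has_mean_le (has_meanD (has_mean_cst P 1) (has_meanZ l Hk))
  (has_mean_expR_normal_centered l mY s0 lawY)) => w.
exact: expR_ge1Dx.
Qed.

End normal_moments.

(* Its value 1 is never needed, since it cancels in correlations. *)
Definition std_normal_variance (R : realType) : R :=
  fine (\int[lebesgue_measure]_x (x ^+ 2 * normal_pdf 0 1 x)%:E)%E.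

Lemma has_mean_variance_normal d (T : measurableType d) (R : realType)
    (P : probability T R) (Y : T -> R) (m s : R) :
  measurable_fun setT Y -> 0 <= s -> has_normal_law P Y m s ->
  has_mean P (fun w => (Y w - m) ^+ 2) (s ^+ 2 * std_normal_variance R).
Proof.
move=> mY s0 lawY; have [c Hc] := has_mean_sqr_exp mY s0 lawY.
have [k Hk] : exists k, has_mean P (fun w => (Y w - m) ^+ 2) k.
  apply: (has_mean_dominated _ Hc) => [|w].
    by apply: measurable_funX; exact: measurable_funB.
  by rewrite ger0_norm ?sqr_ge0// sqr_le_expR.
suff <- : k = s ^+ 2 * std_normal_variance R by [].
have [Hi] := Hk.
rewrite (ge0_integral_normal_law (g := fun y => (y - m) ^+ 2) mY s0 lawY);
  first last.
- by move=> x; exact: sqr_ge0.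
- move=> x; apply: (@continuous_comp _ _ _ (fun y => y - m) (fun y => y ^+ 2)).
    by apply: cvgB; [exact: cvg_id|exact: cvg_cst].
  exact: exprn_continuous.
under eq_integral => x _.
  rewrite addrAC subrr add0r exprMn -mulrA EFinM; over.
rewrite ge0_integralZl//=; first last.
- by rewrite lee_fin sqr_ge0.
- by move=> x _; rewrite lee_fin mulr_ge0 ?sqr_ge0 ?normal_pdf_ge0.
- apply/measurable_EFinP; apply: measurable_funM; first exact: exprn_measurable.
  exact: measurable_normal_pdf.
(* For [s = 0] the factor 0 absorbs the integral, finite or not. Otherwise the integral is finite
   because its product with [s ^+ 2] is the real number [k]. *)
have [->|s_neq0] := eqVneq s 0; first by rewrite expr0n/= mul0e mul0r => -[].
rewrite /std_normal_variance.
set I := (\int[_]_x _)%E => sI.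
have Ifin : I \is a fin_num.
  rewrite -(mule1 I) -[1%E](_ : ((s ^+ 2)^-1)%:E * (s ^+ 2)%:E = 1)%E.
    by rewrite muleCA (muleC I) sI.
  by rewrite -EFinM mulVf// expf_neq0.
by move: sI; rewrite -{1}(fineK Ifin) -EFinM => -[<-].
Qed.

(** * Exponential moments of equicorrelated normal vectors *)

Section equicorrelated.
Context d (T : measurableType d) (R : realType) (P : probability T R).
Variables (n : nat) (X : 'I_n -> {RV P >-> R}) (mu : 'I_n -> R) (rho : R).
Hypothesis marginal : forall i, has_normal_law P (X i) (mu i) 1.
Hypothesis corr : forall i j, i != j -> correlation (X i) (X j) = rho.
Hypothesis joint : jointly_normal X.
Hypothesis rho_gt0 : 0 < rho.

Let V1 := std_normal_variance R.

Lemma has_mean_marginal i : has_mean P (X i) (mu i).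
Proof. exact: (has_mean_normal (measurable_funPT (X i)) ler01 (marginal i)). Qed.

Let has_mean_sqr i : has_mean P (fun w => (X i w - mu i) * (X i w - mu i)) V1.
Proof.
have := has_mean_variance_normal (measurable_funPT (X i)) ler01 (marginal i).
rewrite expr1n mul1r; by under [fun w => _ ^+ 2]funext do rewrite expr2.
Qed.

Let covariance_mean i j c :
  has_mean P (fun w => (X i w - mu i) * (X j w - mu j)) c ->
  fine (covariance P (X i) (X j)) = c.
Proof.
move=> [_ Ec]; have E k : fine ('E_P[X k]) = mu k.
  by rewrite unlock (proj2 (has_mean_marginal k)).
by rewrite unlock !E unlock Ec.
Qed.

Lemma has_mean_cross i j : i != j ->
  V1 != 0 /\
  has_mean P (fun w => (X i w - mu i) * (X j w - mu j)) (rho * V1).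
Proof.
move=> ij; have [c Hc] : exists c,
    has_mean P (fun w => (X i w - mu i) * (X j w - mu j)) c.
  apply: (has_mean_dominated _ (has_meanD (has_mean_sqr i) (has_mean_sqr j))).
    by apply: measurable_funM; exact: measurable_funB.
  move=> w; rewrite ler_norml; set x := _ - _; set y := X j w - mu j.
  by have := sqr_ge0 (x + y); have := sqr_ge0 (x - y); nra.
have V0 : 0 <= V1.
  rewrite /V1 /std_normal_variance fine_ge0// integral_ge0// => x _.
  by rewrite lee_fin mulr_ge0 ?sqr_ge0 ?normal_pdf_ge0.
have := corr ij; rewrite /correlation (covariance_mean Hc) /variance.
rewrite !(covariance_mean (has_mean_sqr _)) -expr2 sqr_sqrtr// => <-.
(* If [V1] were 0, the correlation would be a division by 0, which is 0 by convention, against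
   [rho > 0]. *)
have V10 : V1 != 0.
  apply/eqP => V10; move: rho_gt0; rewrite -(corr ij) /correlation /variance.
  by rewrite !(covariance_mean (has_mean_sqr _)) V10 sqrtr0 mul0r invr0 mulr0
    ltxx.
by rewrite divfK.
Qed.

(** Joint normality only provides some [m] and [s]. The mean of the combination identifies [m];
    computing its second central moment in two ways and cancelling [V1] identifies [s ^+ 2]. *)
Lemma has_mean_expR_linear (a : 'I_n -> R) : (1 < n)%N ->
  has_mean P (fun w => expR (\sum_i a i * (X i w - mu i)))
    (expR (((1 - rho) * (\sum_i a i ^+ 2) + rho * (\sum_i a i) ^+ 2) / 2)).
Proof.
move=> n1; pose i0 := Ordinal (ltnW n1); pose i1 := Ordinal n1.
have [V10 _] : V1 != 0 /\ _ := @has_mean_cross i0 i1 isT.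
have [m [s [s0 law]]] := joint a.
have mY : measurable_fun setT (fun w => \sum_(i < n) a i * X i w).
  by apply: measurable_sum => i; exact: measurable_funM.
have sumE w : \sum_i a i * (X i w - mu i) =
    \sum_i a i * X i w - \sum_i a i * mu i.
  by rewrite -sumrB; apply: eq_bigr => i _; rewrite mulrBr.
have mE : m = \sum_i a i * mu i.
  apply: (has_mean_unique (has_mean_normal mY s0 law)).
  by apply: has_mean_sum => i; apply: has_meanZ; exact: has_mean_marginal.
have := has_mean_expR_normal_centered 1 mY s0 law.
have -> : (fun w => expR (1 * (\sum_i a i * X i w - m))) =
  (fun w => expR (\sum_i a i * (X i w - mu i))).
  by apply/funext => w; rewrite mul1r mE -sumE.
rewrite mul1r; suff -> : s ^+ 2 =
  (1 - rho) * (\sum_i a i ^+ 2) + rho * (\sum_i a i) ^+ 2 by [].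
apply: (mulIf V10).
apply: (has_mean_unique (has_mean_variance_normal mY s0 law)).
pose c i j := if i == j :> 'I_n then V1 else rho * V1.
have -> : ((1 - rho) * (\sum_i a i ^+ 2) + rho * (\sum_i a i) ^+ 2) * V1 =
    \sum_i \sum_j a i * a j * c i j.
  rewrite mulrDl; transitivity (\sum_i ((1 - rho) * a i ^+ 2 * V1 +
      \sum_j a i * a j * (rho * V1))).
    rewrite big_split/= mulr_sumr mulr_suml; congr (_ + _).
    rewrite expr2 mulr_suml mulr_sumr mulr_suml; apply: eq_bigr => i _.
    rewrite mulr_sumr mulr_sumr mulr_suml; apply: eq_bigr => j _.
    by ring.
  apply: eq_bigr => i _; rewrite (bigD1 i)//= [RHS](bigD1 i)//= /c eqxx addrA.
  congr (_ + _); first by ring.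
  by apply: eq_bigr => j; rewrite eq_sym => /negPf ->.
have -> : (fun w => (\sum_i a i * X i w - m) ^+ 2) =
  (fun w => \sum_i \sum_j a i * a j * ((X i w - mu i) * (X j w - mu j))).
  apply/funext => w; rewrite mE -sumE expr2 mulr_suml; apply: eq_bigr => i _.
  by rewrite mulr_sumr; apply: eq_bigr => j _; ring.
do 2![apply: has_mean_sum => ?]; apply: has_meanZ; rewrite /c.
by case: eqVneq => [->|/has_mean_cross[]//]; exact: has_mean_sqr.
Qed.

End equicorrelated.

Lemma sum_indicatorM (R : pzRingType) (I : finType) (i : I) (b : I -> R) :
  \sum_k (k == i)%:R * b k = b i.
Proof.
rewrite (bigD1 i)//= eqxx mul1r big1 ?addr0// => k /negPf ->.
by rewrite mul0r.
Qed.

(** * Average noise and deviations from it *)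

Section deviations.
Context d (T : measurableType d) (R : realType) (P : probability T R).
Variables (n : nat) (X : 'I_n -> {RV P >-> R}) (mu : 'I_n -> R) (rho : R).
Hypothesis marginal : forall i, has_normal_law P (X i) (mu i) 1.
Hypothesis corr : forall i j, i != j -> correlation (X i) (X j) = rho.
Hypothesis joint : jointly_normal X.
Hypothesis rho01 : 0 < rho < 1.
Hypothesis n_gt1 : (1 < n)%N.

Definition noise i w := X i w - mu i.
Definition average_noise w := n%:R^-1 * \sum_i noise i w.
Definition deviation i w := noise i w - average_noise w.
Definition exp_deviation l w := n%:R^-1 * \sum_i expR (l * deviation i w).
(** The moment generating function at [l] of a centered normal variable of variance (1 - rho)(1 -
    1/n), the variance of each deviation. *)
Definition mean_exp_deviation (l : R) :=
  expR (l ^+ 2 * ((1 - rho) * (1 - n%:R^-1)) / 2).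

Let n_gt0 : 0 < n%:R :> R. Proof. by rewrite ltr0n ltnW. Qed.
Let n_neq0 : n%:R != 0 :> R. Proof. by rewrite gt_eqF. Qed.
Let nV_gt0 : 0 < n%:R^-1 :> R. Proof. by rewrite invr_gt0. Qed.
Let nV_le1 : n%:R^-1 <= 1 :> R. Proof. by rewrite invf_le1// ler1n ltnW. Qed.
Let rho_gt0 : 0 < rho. Proof. by case/andP: rho01. Qed.
Let rho_lt1 : rho < 1. Proof. by case/andP: rho01. Qed.
Let linear_mean := has_mean_expR_linear marginal corr joint rho_gt0.

Let sum_const (c : R) : \sum_(k < n) c = c * n%:R.
Proof. by rewrite sumr_const card_ord mulr_natr. Qed.

(** The average noise has variance rho + (1 - rho)/n, at most 1 for every n. *)
Lemma has_mean_average_noise : exists2 v, v <= expR 1 &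
  has_mean P (fun w => expR (average_noise w)) v.
Proof.
have := linear_mean (fun=> n%:R^-1) n_gt1.
rewrite !sumr_const !card_ord.
have -> : (fun w => expR (\sum_i n%:R^-1 * (X i w - mu i))) =
    (fun w => expR (average_noise w)).
  by apply/funext => w; rewrite -mulr_sumr.
move=> H; eexists; last exact: H.
rewrite ler_expR -[n%:R^-1 *+ n]mulr_natr mulVf// expr1n mulr1.
rewrite -[_ ^+ 2 *+ n]mulr_natr expr2 -mulrA mulVf// mulr1.
by move: nV_gt0 nV_le1 rho_gt0 rho_lt1; nra.
Qed.

(** The coefficients [a k] of the noises sum to 0, so the term in [rho] vanishes and only their sum
    of squares remains. *)
Lemma has_mean_deviation2 (l : R) i j :
  has_mean P (fun w => expR (l * (deviation i w + deviation j w)))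
    (expR (l ^+ 2 * (1 - rho) * (1 + (i == j)%:R - 2 / n%:R))).
Proof.
pose a k := l * ((k == i)%:R + (k == j)%:R - 2 / n%:R).
have := linear_mean a n_gt1.
have sum1 (k : 'I_n) : \sum_(k0 < n) (k0 == k)%:R = 1 :> R.
  rewrite -[RHS](sum_indicatorM k (fun=> 1)).
  by apply: eq_bigr => ? _; rewrite mulr1.
have -> : \sum_i a i = 0.
  rewrite -mulr_sumr sumrB big_split/= !sum1 sum_const.
  by field.
have -> : \sum_i a i ^+ 2 = l ^+ 2 * (2 * (1 + (i == j)%:R) - 4 / n%:R).
  (* Indicators are idempotent, so the squared coefficient is linear in each of them and splits into
     [b], [c] and a constant. *)
  pose b k : R := (k == i)%:R * (1 + 2 * (k == j)%:R - 4 / n%:R).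
  pose c k : R := (k == j)%:R * (1 - 4 / n%:R).
  rewrite (eq_bigr (fun k => l ^+ 2 * (b k + c k + 4 / n%:R ^+ 2))); last first.
    move=> k _; rewrite /a /b /c.
    have sqr_bool (x : bool) : (x%:R : R) ^+ 2 = x%:R.
      by case: x; rewrite ?expr1n ?expr0n.
    move: (sqr_bool (k == i)) (sqr_bool (k == j)).
    by set x := (k == i)%:R; set y := (k == j)%:R => x2 y2; field: x2 y2.
  rewrite -mulr_sumr !big_split/= !sum_indicatorM sum_const; congr (_ * _).
  by field.
rewrite expr0n/= mulr0 addr0.
have -> : (fun w => expR (\sum_i a i * (X i w - mu i))) =
    (fun w => expR (l * (deviation i w + deviation j w))).
  apply/funext => w; congr expR.
  rewrite (eq_bigr (fun k => l * ((k == i)%:R * noise k w +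
    (k == j)%:R * noise k w - 2 / n%:R * noise k w))); last first.
    by move=> k _; rewrite /a /noise; ring.
  rewrite -mulr_sumr sumrB big_split/= !sum_indicatorM -mulr_sumr.
  by rewrite /deviation /average_noise; ring.
set u := expR _; set v := expR _; suff -> : u = v by [].
by congr expR; field.
Qed.

Lemma has_mean_deviation (l : R) i :
  has_mean P (fun w => expR (l * deviation i w)) (mean_exp_deviation l).
Proof.
have := has_mean_deviation2 (l / 2) i i; rewrite eqxx mulr1n.
have -> : (fun w => expR (l / 2 * (deviation i w + deviation i w))) =
    (fun w => expR (l * deviation i w)).
  by apply/funext => w; congr expR; field.
set v := expR _; suff -> : v = mean_exp_deviation l by [].
by rewrite /v /mean_exp_deviation; congr expR; field.
Qed.

Lemma has_mean_exp_deviation (l : R) :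
  has_mean P (exp_deviation l) (mean_exp_deviation l).
Proof.
have -> : mean_exp_deviation l =
    n%:R^-1 * \sum_(i < n) mean_exp_deviation l.
  by rewrite sumr_const card_ord -[X in _ * X]mulr_natr mulrCA mulVf// mulr1.
by apply: has_meanZ; apply: has_mean_sum => i; exact: has_mean_deviation.
Qed.

Lemma mean_exp_deviation_le (l : R) :
  mean_exp_deviation l <= expR (l ^+ 2 * (1 - rho) / 2).
Proof.
rewrite ler_expR ler_pM2r ?invr_gt0// ler_wpM2l ?sqr_ge0//.
by rewrite ler_piMr ?subr_ge0 ?gerBl// ltW.
Qed.

(* Distinct deviations are negatively correlated, so only the diagonal terms
   contribute to the variance. *)
Lemma has_mean_exp_deviation_sqr (l : R) :
  exists2 v, v <= expR (2 * l ^+ 2) / n%:R &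
    has_mean P (fun w => (exp_deviation l w - mean_exp_deviation l) ^+ 2) v.
Proof.
set e := mean_exp_deviation l.
pose M i j := expR (l ^+ 2 * (1 - rho) * (1 + (i == j :> 'I_n)%:R - 2 / n%:R)).
have sqrE : (fun w => (exp_deviation l w - e) ^+ 2) = (fun w =>
    n%:R^-2 * (\sum_i \sum_j expR (l * (deviation i w + deviation j w))) +
    (- (2 * e) * exp_deviation l w + cst (e ^+ 2) w)).
  apply/funext => w; rewrite sqrrB -addrA; congr (_ + _); last first.
    by rewrite /cst; ring.
  rewrite /exp_deviation exprMn exprVn; congr (_ * _).
  rewrite expr2 mulr_suml; apply: eq_bigr => i _; rewrite mulr_sumr.
  by apply: eq_bigr => j _; rewrite (mulrDr l (deviation i w)) expRD.
rewrite sqrE; eexists; last first.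
  apply: has_meanD.
    apply: has_meanZ; do 2![apply: has_mean_sum => ?].
    exact: has_mean_deviation2.
  apply: has_meanD; last exact: has_mean_cst.
  by apply: has_meanZ; exact: has_mean_exp_deviation.
rewrite -/e -/(M _ _).
have e2 : e ^+ 2 = expR (l ^+ 2 * (1 - rho) * (1 - n%:R^-1)).
  by rewrite (expr2 e) /e /mean_exp_deviation -expRD; congr expR; field.
have l0 : 0 <= l ^+ 2 * (1 - rho).
  by rewrite mulr_ge0 ?sqr_ge0// subr_ge0 ltW.
(* Off the diagonal the factor is 1 - 2/n, below the 1 - 1/n in [e ^+ 2]; on the diagonal it is 2 -
   2/n, at most 2. *)
have Mle i j : M i j <= e ^+ 2 + (i == j)%:R * expR (2 * l ^+ 2).
  rewrite /M; case: eqP => [_|_]; last first.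
    rewrite mulr0n mul0r !addr0 e2 ler_expR ler_wpM2l//.
    by move: nV_gt0; lra.
  rewrite mulr1n mul1r ler_wpDl ?sqr_ge0// ler_expR mulrC.
  apply: ler_pM => //.
  - by move: nV_le1; lra.
  - by move: nV_gt0; lra.
  - by rewrite ler_piMr ?sqr_ge0// gerBl ltW.
apply: (@le_trans _ _ (n%:R^-2 * (\sum_(i < n) \sum_(j < n)
   (e ^+ 2 + (i == j)%:R * expR (2 * l ^+ 2))) + (- (2 * e) * e + e ^+ 2))).
  rewrite lerD2r ler_pM2l ?invr_gt0 ?exprn_gt0//.
  by do 2![apply: ler_sum => ? _]; exact: Mle.
have -> : \sum_(i < n) \sum_(j < n) (e ^+ 2 + (i == j)%:R * expR (2 * l ^+ 2)) =
    n%:R ^+ 2 * e ^+ 2 + n%:R * expR (2 * l ^+ 2).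
  under eq_bigr => i _.
    rewrite big_split/= sum_const.
    under [X in _ + X]eq_bigr do rewrite eq_sym.
    rewrite (sum_indicatorM i (fun=> expR (2 * l ^+ 2))).
    over.
  by rewrite sum_const; ring.
rewrite le_eqVlt; apply/orP; left; apply/eqP.
by field.
Qed.

(* Any rejection forces one of the five summands to be at least 1. *)
Definition rejection_bound (K x t s l : R) w :=
  expR (average_noise w - K) + \sum_i expR (l * (deviation i w - x)) +
  2 / n%:R * (\sum_i expR (noise i w - t)) +
  (exp_deviation (- s) w - mean_exp_deviation (- s)) ^+ 2 +
  exp_deviation (- (2 * s)) w / Num.sqrt n%:R.

(** The bounds follow the order of the summands. The first and third will be made small by [K] and
    [t], the second by letting [x] and [l] grow with n, the last two by n alone once [s] is
    fixed. *)
Lemma rejection_bound_mean (K x t s l : R) :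
  exists2 v, v <= expR (1 - K) +
      n%:R * expR (l ^+ 2 * (1 - rho) / 2 - l * x) + 2 * expR (1 - t) +
      expR (2 * s ^+ 2) / n%:R + expR (2 * s ^+ 2) / Num.sqrt n%:R &
    has_mean P (rejection_bound K x t s l) v.
Proof.
have [v1 v1le H1] := has_mean_average_noise.
have [v4 v4le H4] := has_mean_exp_deviation_sqr (- s).
eexists; last first.
  rewrite /rejection_bound; apply: has_meanD;
    [apply: has_meanD; [apply: has_meanD; [apply: has_meanD|]|]|].
  - rewrite (_ : (fun w => _) = (fun w => expR (- K) * expR (average_noise w))).
      by apply: has_meanZ; exact: H1.
    by apply/funext => w; rewrite -expRD addrC.
  - apply: has_mean_sum => i.
    rewrite (_ : (fun w => _) =
      (fun w => expR (- (l * x)) * expR (l * deviation i w))).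
      by apply: has_meanZ; exact: has_mean_deviation.
    by apply/funext => w; rewrite -expRD mulrBr addrC.
  - apply: has_meanZ; apply: has_mean_sum => i.
    rewrite (_ : (fun w => _) =
      (fun w => expR (- t) * expR (1 * (X i w - mu i)))).
      apply: has_meanZ; apply: (has_mean_expR_normal_centered _
        (measurable_funPT (X i)) ler01 (marginal i)).
    by apply/funext => w; rewrite -expRD mul1r addrC.
  - exact: H4.
  - rewrite (_ : (fun w => _) =
      (fun w => (Num.sqrt n%:R)^-1 * exp_deviation (- (2 * s)) w)).
      by apply: has_meanZ; exact: has_mean_exp_deviation.
    by apply/funext => w; rewrite mulrC.
rewrite !sumr_const !card_ord; repeat apply: lerD.
- by rewrite expRD mulrC ler_pM2r// expR_gt0.
- rewrite mulr_natl ler_wMn2r// expRD mulrC ler_pM2r ?expR_gt0//.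
  exact: mean_exp_deviation_le.
- rewrite -[X in 2 / n%:R * X]mulr_natr mulrACA mulVf// mulr1 ler_pM2l//.
  by rewrite -expRD ler_expR mulr1 expr1n; lra.
- by rewrite -(sqrrN s).
- rewrite mulrC ler_pM2r ?invr_gt0 ?sqrtr_gt0//.
  apply: (le_trans (mean_exp_deviation_le _)); rewrite ler_expR sqrrN.
  rewrite (_ : _ / 2 = 2 * s ^+ 2 - 2 * (rho * s ^+ 2)); last by field.
  by rewrite gerBl mulr_ge0// mulr_ge0 ?sqr_ge0// ltW.
Qed.

Lemma rejection_bound_ge0 (K x t s l : R) w : 0 <= rejection_bound K x t s l w.
Proof.
rewrite /rejection_bound; do 4?[apply: addr_ge0].
- exact: expR_ge0.
- by apply: sumr_ge0 => ? _; exact: expR_ge0.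
- apply: mulr_ge0; first by rewrite divr_ge0// ltW.
  by apply: sumr_ge0 => ? _; exact: expR_ge0.
- exact: sqr_ge0.
- apply: divr_ge0 => //; apply: mulr_ge0; first exact: ltW.
  by apply: sumr_ge0 => ? _; exact: expR_ge0.
Qed.

End deviations.

(** * Ordered p-values and measurability of step-up procedures *)

Section ordered_pvalues.
Context (R : realType) (n : nat).
Implicit Types (p : 'I_n -> R) (u : nat -> R).

Lemma size_ordering p : size (ordering p) = n.
Proof. by rewrite size_sort size_enum_ord. Qed.

Lemma ordered_pvalueE p k i0 : (k.-1 < n)%N ->
  ordered_pvalue p k = p (nth i0 (ordering p) k.-1).
Proof. by move=> kn; rewrite /ordered_pvalue (nth_map i0) ?size_ordering. Qed.

Lemma ordered_pvalue_le_card p k (x : R) : (0 < k <= n)%N ->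
  ordered_pvalue p k <= x -> (k <= #|[set i | (p i <= x)%R]%SET|)%N.
Proof.
move=> /andP[k0 kn] px; have i0 : 'I_n by exists 0%N; exact: leq_trans k0 kn.
have kn' : (k.-1 < n)%N by rewrite prednK.
rewrite -{1}(_ : size (take k (ordering p)) = k); last first.
  by rewrite size_takel// size_ordering.
rewrite cardE; apply: uniq_leq_size.
  by rewrite take_uniq// sort_uniq enum_uniq.
move=> i iP; rewrite mem_enum inE; apply: le_trans px.
rewrite (ordered_pvalueE _ i0)//.
have leT : total (fun i j => p i <= p j) by move=> a b; exact: le_total.
have tr : transitive (fun i j => p i <= p j) by move=> a b c; exact: le_trans.
have := sort_sorted leT (enum 'I_n); rewrite -/(ordering p) => srt.
have idx : (index i (take k (ordering p)) < k)%N.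
  rewrite -{2}(_ : size (take k (ordering p)) = k) ?index_mem//.
  by rewrite size_takel// size_ordering.
rewrite -(nth_index i0 iP) nth_take//.
apply: (sorted_leq_nth tr _ i0 srt) => //.
- by rewrite inE size_ordering (leq_trans idx).
- by rewrite inE size_ordering.
- by rewrite -ltnS prednK.
Qed.

(** If no ordered p-value meets its cutoff, the maximum is over an empty family, hence 0, and
    [take 0] rejects nothing. *)
Lemma step_up_rejects u p i : i \in step_up u p ->
  exists2 k, (0 < k <= n)%N & ordered_pvalue p k <= u k.
Proof.
rewrite inE => im; apply: contrapT => H; move: im.
rewrite big_nat_cond big_pred0 ?take0// => k; apply/negP => /andP[kn ku].
by apply: H; exists k.
Qed.

(** The procedure sees the p-values only through finitely many comparisons; this reduces its
    measurability to that of boolean functions. *)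
Lemma step_up_comparisons u p q :
  (forall i j, (p i <= p j) = (q i <= q j)) ->
  (forall i k, (k <= n)%N -> (p i <= u k) = (q i <= u k)) ->
  step_up u p = step_up u q.
Proof.
move=> pq pu; have oE : ordering p = ordering q.
  by rewrite /ordering; congr sort; apply/funext => i; apply/funext => j.
rewrite /step_up oE
  (_ : \max_(1 <= k < n.+1 | (ordered_pvalue p k <= u k)%R) k =
  \max_(1 <= k < n.+1 | (ordered_pvalue q k <= u k)%R) k)%N//.
rewrite big_nat_cond [RHS]big_nat_cond; apply: eq_bigl => k.
case: (boolP (1 <= k < n.+1)%N) => //= /andP[k0 kn].
have i0 : 'I_n by exists 0%N; exact: leq_trans k0 kn.
have kn' : (k.-1 < n)%N by rewrite prednK.
by rewrite !(ordered_pvalueE _ i0)// oE pu.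
Qed.

End ordered_pvalues.

Lemma measurable_bool_family d (T : measurableType d) (K : finType)
    (b : K -> T -> bool) (Q : pred {ffun K -> bool}) :
  (forall k, measurable_fun setT (b k)) ->
  measurable [set w | Q [ffun k => b k w]].
Proof.
move=> mb; rewrite (_ : [set w | _] =
    \bigcup_(c in [set c | Q c]) \bigcap_(k in [set: K]) (b k @^-1` [set c k])).
  apply: fin_bigcup_measurable => // c _.
  apply: fin_bigcap_measurable => // k _.
  by rewrite -[X in measurable X]setTI; exact: mb.
apply/seteqP; split => [w Qw|w [c /= Qc bc]]; last first.
  rewrite (_ : [ffun k => b k w] = c)//; apply/ffunP => k.
  by rewrite ffunE; exact: bc.
by exists [ffun k => b k w] => //= k _; rewrite /= ffunE.
Qed.

Lemma measurable_step_up d (T : measurableType d) (R : realType) (n : nat)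
    (p : 'I_n -> T -> R) (u : nat -> R) (Q : pred {set 'I_n}) :
  (forall i, measurable_fun setT (p i)) ->
  measurable [set w | Q (step_up u (fun i => p i w))].
Proof.
move=> mp; pose K : finType := ('I_n * 'I_n + 'I_n * 'I_n.+1)%type.
pose b (k : K) w := match k with
  | inl (i, j) => p i w <= p j w
  | inr (i, j) => p i w <= u j
  end.
have mb k : measurable_fun setT (b k).
  by case: k => -[i j]; apply: measurable_fun_ler.
(* A pattern of comparisons is accepted if some sample point realizes it and satisfies [Q]; the
   choice of the point is immaterial by [step_up_comparisons]. *)
pose Q' (c : {ffun K -> bool}) := `[< exists2 w, c = [ffun k => b k w] &
  Q (step_up u (fun i => p i w)) >].
rewrite (_ : [set w | _] = [set w | Q' [ffun k => b k w]]).
  exact: measurable_bool_family.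
apply/seteqP; split => [w Qw|w /asboolP[v /ffunP wv]] /=.
  by apply/asboolP; exists w.
rewrite (@step_up_comparisons _ _ u _ (fun i => p i v))// => i.
  by move=> j; have := wv (inl (i, j)); rewrite !ffunE.
move=> k kn; have := wv (inr (i, Ordinal (kn : (k < n.+1)%N))).
by rewrite !ffunE.
Qed.

(** * Tails of the standard normal law *)

Section normal_tail.
Context (R : realType).
Implicit Types (x t a : R).

Lemma le_Phi x t : x <= t -> Phi x <= Phi t.
Proof.
move=> xt; rewrite /Phi fine_le ?fin_num_measure//.
by apply: le_measure; rewrite ?inE//; exact: subitvPr.
Qed.

Lemma measurable_Phi : measurable_fun setT (@Phi R).
Proof. by apply: nondecreasing_measurable => // x y; exact: le_Phi. Qed.

Lemma Phi_lt x t a : 1 - Phi x <= a -> a < 1 - Phi t -> t < x.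
Proof.
move=> xa at_; rewrite ltNge; apply/negP => /le_Phi xt.
by have := le_lt_trans xa at_; rewrite ltrD2l ltrN2 ltNge xt.
Qed.

(** The interval from t to t + 1 has length 1, and the density there is at least its value at t +
    1. *)
Lemma Phi_tail_lb t : 0 <= t ->
  normal_peak 1 * expR (- ((t + 1) ^+ 2 / 2)) <= 1 - Phi t.
Proof.
move=> t0; set c := normal_peak 1 * _.
rewrite -lee_fin EFinB /Phi fineK ?fin_num_measure//.
rewrite -probability_setC// setCitvl.
apply: (@le_trans _ _ (normal_prob 0 1 `]t, t + 1])); last first.
  apply: le_measure; rewrite ?inE// => x.
  by rewrite /= !in_itv/= andbT => /andP[].
rewrite /normal_prob.
apply: (@le_trans _ _ (\int[lebesgue_measure]_(x in `]t, (t + 1)%R]) c%:E)%E).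
  rewrite integral_cst//= lebesgue_measure_itv/= lte_fin ltrDl ltr01.
  by rewrite -EFinB addrAC subrr add0r mule1.
apply: ge0_le_integral => //.
- by move=> x _; rewrite lee_fin mulr_ge0 ?normal_peak_ge0 ?expR_ge0.
- by apply/measurable_EFinP/measurable_funTS; exact: measurable_normal_pdf.
- move=> x; rewrite /= in_itv/= => /andP[tx xt1].
  rewrite lee_fin normal_pdfE ?oner_eq0// ler_pM2l ?normal_peak_gt0 ?oner_eq0//.
  rewrite ler_expR expr1n subr0 mulNr lerN2 ler_pM2r ?invr_gt0//.
  by rewrite lerXn2r ?nnegrE ?addr_ge0// (le_trans t0)// ltW.
Qed.

(** Markov's inequality for expR (x - Y), with Y standard normal, whose mean is expR (x + 1/2). *)
Lemma Phi_le_expR x : Phi x <= expR (x + 1).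
Proof.
have mid : measurable_fun setT (idfun : measurableTypeR R -> R).
  exact: measurable_id.
have law :
    has_normal_law (normal_prob 0 1) (idfun : measurableTypeR R -> R) 0 1.
  by move=> B mB; rewrite /normal_law oner_eq0.
have mean_exp := has_meanZ (expR x) (has_mean_expR_normal (-1) mid ler01 law).
rewrite /Phi -lee_fin fineK ?fin_num_measure//.
apply: (le_trans (probability_le_mean _ mean_exp _ _)) => //.
- move=> w; rewrite /= in_itv/= => wx.
  by rewrite -expRD -[leLHS]expR0 ler_expR mulN1r subr_ge0.
- rewrite lee_fin -expRD ler_expR lerD2l mulr0 add0r mulr1 sqrrN expr1n.
  by rewrite ler_pdivrMr// mul1r ler1n.
Qed.

Lemma Phi_tail_gt a : a < 1 -> exists c, a < 1 - Phi c.
Proof.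
move=> a1; exists (ln ((1 - a) / 2) - 1).
have a0 : 0 < (1 - a) / 2 by rewrite divr_gt0// subr_gt0.
have := Phi_le_expR (ln ((1 - a) / 2) - 1); rewrite subrK lnK ?posrE//.
by move: a0; lra.
Qed.

End normal_tail.

(** * Rejection implies a large deviation *)

Section rejection_bound_ge1.
Context d (T : measurableType d) (R : realType) (P : probability T R).
Variables (n : nat) (X : 'I_n -> {RV P >-> R}) (mu : 'I_n -> R) (rho : R).
Hypothesis n_gt1 : (1 < n)%N.
Variables (alpha M K c t tn s l : R) (J : nat).
Hypothesis alpha_gt0 : 0 < alpha.
Hypothesis J_gt0 : (0 < J)%N.
Hypothesis J_le : J%:R <= Num.sqrt n%:R :> R.
Hypothesis mu_le : forall i, mu i <= M.
Hypothesis c_tail : alpha < 1 - Phi c.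
Hypothesis t_tail : alpha / J%:R < 1 - Phi t.
Hypothesis tn_tail : 2 * alpha / n%:R < 1 - Phi tn.
Hypothesis s_gt0 : 0 < s.
Hypothesis l_gt0 : 0 < l.
Hypothesis s_large :
  expR (s * (M + K - c)) + 3 <= mean_exp_deviation n rho (- s).

Let n_gt0 : 0 < n%:R :> R. Proof. by rewrite ltr0n ltnW. Qed.

(** For an index outside [A], put y = expR (- s * deviation) and L = sqrt n: then y <= L + y^2 / L,
    and y^2 is the exponential with [2 * s]. Averaging turns the terms L into [#|~: A|] / L. *)
Lemma exp_deviation_le (A : {set 'I_n}) b w :
  (forall i, i \in A -> - b <= deviation X mu i w) ->
  exp_deviation X mu (- s) w <= expR (s * b) +
    #|~: A|%:R / Num.sqrt n%:R +
    exp_deviation X mu (- (2 * s)) w / Num.sqrt n%:R.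
Proof.
move=> Ab; set L := Num.sqrt n%:R.
have L0 : 0 < L by rewrite sqrtr_gt0.
have LL : L * L = n%:R by rewrite -expr2 sqr_sqrtr// ltW.
rewrite -(ler_pM2l n_gt0) /exp_deviation mulrA divff ?gt_eqF// mul1r.
have -> : n%:R * (expR (s * b) + #|~: A|%:R / L +
    n%:R^-1 * (\sum_i expR (- (2 * s) * deviation X mu i w)) / L) =
  \sum_i (expR (s * b) + (i \in ~: A)%:R * L +
    expR (- (2 * s) * deviation X mu i w) / L).
  have cardE : \sum_i (i \in ~: A)%:R = #|~: A|%:R :> R.
    rewrite -sum1_card natr_sum [RHS]big_mkcond; apply: eq_bigr => i _.
    by case: ifP.
  rewrite !big_split/= sumr_const card_ord -!mulr_suml cardE.
  rewrite -[expR (s * b) *+ n]mulr_natr -LL.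
  by field; rewrite gt_eqF.
apply: ler_sum => i _.
set y := deviation X mu i w.
have -> : expR (- (2 * s) * y) = expR (- s * y) * expR (- s * y).
  by rewrite -expRD; congr expR; ring.
rewrite inE; case: (boolP (i \in A)) => [iA|_].
  rewrite mul0r addr0; apply: (@le_trans _ _ (expR (s * b))).
    by rewrite ler_expR mulNr -mulrN ler_pM2l// lerNl; exact: Ab.
  by rewrite lerDl divr_ge0 ?mulr_ge0 ?expR_ge0// ltW.
rewrite mul1r -addrA; apply: (@le_trans _ _ (L +
    expR (- s * y) * expR (- s * y) / L)); last by rewrite lerDr expR_ge0.
rewrite -(ler_pM2r L0) mulrDl divfK ?gt_eqF//.
by have := sqr_ge0 (expR (- s * y) - L); have := expR_gt0 (- s * y); nra.
Qed.

Lemma rejection_bound_ge1 w i : i \in hochberg alpha (pvalues X w) ->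
  1 <= rejection_bound X mu rho K (tn - M - K) (t - M) s l w.
Proof.
(* The cutoff is alpha / j, and at least k = n - j + 1 p-values lie below it, so at most j - 1
   exceed it. *)
move=> /step_up_rejects[k /andP[k_gt0 k_le]]; set j := (n - k + 1)%N => pk.
have := ordered_pvalue_le_card _ pk; rewrite k_gt0 k_le => /(_ isT).
set A := [set i0 | _]%SET => kA.
have L0 : 0 < Num.sqrt n%:R :> R by rewrite sqrtr_gt0.
rewrite leNgt; apply/negP => bound_lt1.
pose T1 : R := expR (average_noise X mu w - K).
pose T2 : R := \sum_i0 expR (l * (deviation X mu i0 w - (tn - M - K))).
pose S3 : R := \sum_i0 expR (noise X mu i0 w - (t - M)).
pose T4 : R :=
  (exp_deviation X mu (- s) w - mean_exp_deviation n rho (- s)) ^+ 2.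
pose T5 : R := exp_deviation X mu (- (2 * s)) w / Num.sqrt n%:R.
rewrite -[X in X < 1]/(T1 + T2 + 2 / n%:R * S3 + T4 + T5) in bound_lt1.
have T10 : 0 <= T1 by exact: expR_ge0.
have T20 : 0 <= T2 by apply: sumr_ge0 => ? _; exact: expR_ge0.
have S30 : 0 <= 2 / n%:R * S3.
  rewrite mulr_ge0 ?divr_ge0 ?(ltW n_gt0)//.
  by apply: sumr_ge0 => ? _; exact: expR_ge0.
have T40 : 0 <= T4 by exact: sqr_ge0.
have T50 : 0 <= T5.
  rewrite divr_ge0 ?(ltW L0)// mulr_ge0 ?invr_ge0 ?(ltW n_gt0)//.
  by apply: sumr_ge0 => ? _; exact: expR_ge0.
have average_lt : average_noise X mu w < K.
  by rewrite -subr_lt0 -expR_lt1 -/T1; move: T10 T20 S30 T40 T50 bound_lt1; lra.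
have deviation_lt i0 : deviation X mu i0 w < tn - M - K.
  rewrite -subr_lt0 -(pmulr_rlt0 _ l_gt0) -expR_lt1.
  apply: (@le_lt_trans _ _ T2).
    rewrite /T2 (bigD1 i0)//= lerDl; apply: sumr_ge0 => ? _; exact: expR_ge0.
  by move: T10 T20 S30 T40 T50 bound_lt1; lra.
have j_gt0 : 0 < j%:R :> R by rewrite ltr0n /j addn1.
have p_lt i0 a : i0 \in A -> alpha / j%:R <= a -> forall x, a < 1 - Phi x ->
    x < X i0 w.
  rewrite inE => pi0 aj x; apply: Phi_lt; exact: le_trans pi0 aj.
have noise_gt i0 x : x < X i0 w -> x - M < noise X mu i0 w.
  by move=> xX; rewrite /noise ltr_leB.
(* Here alpha / j <= 2 alpha / n, so some X_i exceeds [tn], which contradicts [deviation_lt] and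
   [average_lt]. *)
have [nj|nj] := leqP n (2 * j).
  have /card_gt0P[i0 i0A] : (0 < #|A|)%N by exact: leq_trans k_gt0 kA.
  have : tn < X i0 w.
    apply: (p_lt _ _ i0A _ _ tn_tail).
    rewrite ler_pdivrMr// mulrAC ler_pdivlMr// mulrAC [leRHS]mulrC ler_pM2l//.
    by rewrite -natrM ler_nat.
  move=> /noise_gt; have := deviation_lt i0; rewrite /deviation.
  by move: average_lt; lra.
(* Each index of [A] contributes at least 1 to [S3], and [A] contains at least half of the indices,
   so the third summand is at least 1. *)
have [Jj|jJ] := leqP J j.
  have AS3 : #|A|%:R <= S3.
    rewrite -sum1_card natr_sum big_mkcond/=; apply: ler_sum => i0 _.
    case: ifPn => [i0A|_]; last exact: expR_ge0.
    rewrite -[leLHS]expR0 ler_expR subr_ge0 ltW// noise_gt//.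
    apply: (p_lt _ _ i0A _ _ t_tail).
    by rewrite ler_pM2l// lef_pV2 ?posrE// ?ltr0n// ler_nat.
  have : 2 * S3 < n%:R.
    rewrite -(ltr_pM2l (_ : 0 < n%:R^-1)) ?invr_gt0// mulVf ?gt_eqF// mulrA.
    rewrite [_ * 2]mulrC; move: T10 T20 S30 T40 T50 bound_lt1; lra.
  have nA : (n <= 2 * #|A|)%N.
    by move: kA nj k_le; rewrite /j; clear; move: #|A| => a; lia.
  have : n%:R <= 2 * #|A|%:R :> R by rewrite -natrM ler_nat.
  by move: AS3; lra.
(* Now fewer than J <= sqrt n indices lie outside [A]. The 3 in [s_large] pays for these indices,
   for [T5 < 1] and for the fluctuation allowed by [T4 < 1]. *)
have Ab i0 : i0 \in A -> - (M + K - c) <= deviation X mu i0 w.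
  move=> i0A; have : c < X i0 w.
    apply: (p_lt _ _ i0A _ _ c_tail).
    by rewrite ler_pdivrMr// ler_pMr// ler1n /j addn1.
  by move=> /noise_gt; rewrite /deviation; move: average_lt; lra.
have := exp_deviation_le Ab.
have cardC : #|~: A|%:R / Num.sqrt n%:R <= 1 :> R.
  rewrite ler_pdivrMr// mul1r; apply: le_trans J_le; rewrite ler_nat.
  have := cardsC A; rewrite card_ord; move: kA k_le jJ; rewrite /j; clear.
  by move: #|A| #|~: A| => a a'; lia.
have : mean_exp_deviation n rho (- s) - 1 < exp_deviation X mu (- s) w.
  have sqr_lt (z e : R) : (z - e) ^+ 2 < 1 -> e - 1 < z.
    by move=> ze; rewrite ltNge; apply/negP => ez; move: ze ez; nra.
  apply: sqr_lt; rewrite -/T4.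
  by move: T10 T20 S30 T40 T50 bound_lt1; lra.
have : T5 < 1 by move: T10 T20 S30 T40 T50 bound_lt1; lra.
by rewrite -/T5; move: s_large cardC; lra.
Qed.

End rejection_bound_ge1.

(** * Choice of the constants and conclusion *)

(* The deviations have standard deviation at most [sqrt (1 - rho)] whereas the
   quantile [u] is computed for a unit variance: this is what beats the union
   bound over [n ~ expR (u ^+ 2 / 2)] variables. *)
Lemma gaussian_union_bound (R : realType) (rho a delta : R) :
  0 < rho < 1 -> 0 < delta ->
  exists2 U, 1 <= U & forall u, U <= u ->
    expR (u ^+ 2 / 2 - (u - a) ^+ 2 / (2 * (1 - rho))) <= delta.
Proof.
move=> /andP[rho0 rho1] delta0.
(* The three terms ensure 1 <= u, |a| <= rho u / 4 and |ln delta| <= rho u / 4. The exponent is then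
   at most - rho u / 4. *)
exists (1 + 4 * `|a| / rho + 4 * `|ln delta| / rho).
  by rewrite -addrA lerDl addr_ge0// divr_ge0 ?mulr_ge0// ltW.
move=> u; set A := 4 * `|a| / rho; set B := 4 * _ / rho => uU.
have A0 : 0 <= A by rewrite divr_ge0 ?mulr_ge0// ltW.
have B0 : 0 <= B by rewrite divr_ge0 ?mulr_ge0// ltW.
have u1 : 1 <= u by lra.
have aA : `|a| = rho / 4 * A by rewrite /A; field; rewrite gt_eqF.
have dB : `|ln delta| = rho / 4 * B by rewrite /B; field; rewrite gt_eqF.
have r1 : 0 < 1 - rho by rewrite subr_gt0.
have au : `|a| <= rho / 4 * u by rewrite aA ler_pM2l; lra.
have du : `|ln delta| <= rho / 4 * u by rewrite dB ler_pM2l; lra.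
rewrite -[leRHS]lnK ?posrE// ler_expR.
apply: (@le_trans _ _ (- (rho / 4 * u))); last first.
  by rewrite lerNl; apply: le_trans du; rewrite -normrN ler_norm.
have sq : (1 - rho / 2) * u ^+ 2 <= (u - a) ^+ 2.
  have aa : a <= `|a| := ler_norm a.
  have : a * u <= rho / 4 * u * u by rewrite ler_pM2r; lra.
  by have := sqr_ge0 a; nra.
rewrite -(ler_pM2r (_ : 0 < 2 * (1 - rho))) ?mulr_gt0//.
rewrite mulrBl divfK ?gt_eqF ?mulr_gt0//.
have uu : u <= u ^+ 2 by nra.
have : rho / 4 * u <= rho / 4 * u ^+ 2 by rewrite ler_pM2l//; lra.
have r2 : 0 <= rho * (1 - rho) * u ^+ 2.
  by rewrite mulr_ge0 ?sqr_ge0// mulr_ge0// ltW.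
have r3 : 0 <= rho * rho * u ^+ 2 by rewrite mulr_ge0 ?sqr_ge0// mulr_ge0// ltW.
move=> H; have := ler_wpM2r (ltW r1) H.
by nra.
Qed.

(** The exponent on the right is quadratic in [s], and 1 - 1/n >= 1/2 makes the choice uniform in n.
    The witness solves s^2 (1 - rho) / 4 = s (|b| + 3). *)
Lemma mean_exp_deviation_large (R : realType) (rho b : R) : 0 < rho < 1 ->
  exists2 s, 0 < s & forall n, (1 < n)%N ->
    expR (s * b) + 3 <= mean_exp_deviation n rho (- s).
Proof.
move=> /andP[rho0 rho1]; have r1 : 0 < 1 - rho by rewrite subr_gt0.
pose s := 4 * (`|b| + 3) / (1 - rho).
have b0 : 0 <= `|b| := normr_ge0 b.
have s1 : 1 <= s by rewrite ler_pdivlMr//; lra.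
have s0 : 0 < s by lra.
exists s => // n n1.
have nV : n%:R^-1 <= 2^-1 :> R.
  by rewrite lef_pV2 ?posrE ?ltr0n ?(ltnW n1)// ler_nat.
apply: (@le_trans _ _ (expR (s * `|b|) * expR (s * 3))); last first.
  rewrite -expRD ler_expR sqrrN.
  have -> : s * `|b| + s * 3 = s ^+ 2 * ((1 - rho) * 2^-1) / 2.
    by rewrite /s; field; rewrite gt_eqF.
  rewrite ler_pM2r// ler_wpM2l ?sqr_ge0// ler_wpM2l ?(ltW r1)//; lra.
have e1 : expR (s * b) <= expR (s * `|b|).
  by rewrite ler_expR ler_pM2l// ler_norm.
have e2 : 1 <= expR (s * `|b|) by rewrite -[leLHS]expR0 ler_expR mulr_ge0// ltW.
have e3 := expR_ge1Dx (s * 3).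
by nra.
Qed.

Theorem corollary6p2 (R : realType) (rho : R) (mu : nat -> R)
    (d : nat -> measure_display) (T : forall n : nat, measurableType (d n))
    (P : forall n : nat, probability (T n) R)
    (X : forall n : nat, 'I_n -> {RV (P n) >-> R})
    (hrho : 0 < rho < 1)
    (hmu : forall i : nat, 0 <= mu i)
    (hjoint : forall n : nat, jointly_normal (X n))
    (hmarg : forall (n : nat) (i : 'I_n), has_normal_law (P n) (X n i) (mu i) 1)
    (hcorr : forall (n : nat) (i j : 'I_n), i != j ->
      correlation (X n i) (X n j) = rho)
    (hsup : (ereal_sup (range (EFin \o mu)) < +oo)%E)
    (alpha : R) (halpha : 0 < alpha < 1 / 2) :
  any_power (X n) (fun i : 'I_n => mu i) (@hochberg R alpha n)
    @[n --> \oo] --> 0%E.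
Proof.
have /andP[rho0 rho1] := hrho; have /andP[alpha0 alpha12] := halpha.
have alpha1 : alpha < 1 by lra.
pose M := fine (ereal_sup (range (EFin \o mu))).
have mu_le i : mu i <= M.
  have mu_sup : ((mu i)%:E <= ereal_sup (range (EFin \o mu)))%E.
    by apply: ereal_sup_ubound; exists i.
  rewrite -lee_fin fineK// fin_real// hsup andbT.
  by apply: lt_le_trans mu_sup; rewrite ltNyr.
pose rejects n := [set w | (1 <= true_positives (fun i : 'I_n => mu i)
  (hochberg alpha (pvalues (X n) w)))%N].
have mrejects n : measurable (rejects n).
  apply: (@measurable_step_up _ (T n) R n (fun i w => 1 - Phi (X n i w)) _
    (fun A => (1 <= true_positives (fun i : 'I_n => mu i) A)%N)) => i.
  apply: measurable_funB => //.
  by apply: measurableT_comp => //; exact: measurable_Phi.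
apply/fine_cvgP; split.
  by apply: nearW => n; apply: fin_num_measure; exact: mrejects.
apply/cvgr0Pnorm_le => e e0.
(* Each of the five terms of [rejection_bound_mean] receives a budget of [e / 5]. *)
pose K := 1 - ln (e / 5).
have K_small : expR (1 - K) <= e / 5.
  by rewrite /K subKr lnK// posrE divr_gt0.
(* The maximum with 0 makes [Phi_tail_lb] applicable at [t]. *)
pose t := Num.max 0 (M + 1 - ln (e / 10)).
have t_small : 2 * expR (1 - (t - M)) <= e / 5.
  apply: (@le_trans _ _ (2 * expR (ln (e / 10)))).
    rewrite ler_pM2l// ler_expR.
    have : M + 1 - ln (e / 10) <= t by rewrite /t le_max lexx orbT.
    by lra.
  by rewrite lnK ?posrE ?divr_gt0//; lra.
have t0 : 0 <= t by rewrite /t le_max lexx.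
have peak0 : 0 < normal_peak 1 :> R by rewrite normal_peak_gt0// oner_eq0.
have tail0 : 0 < 1 - Phi t.
  by apply: lt_le_trans (Phi_tail_lb t0); rewrite mulr_gt0// expR_gt0.
have [c c_tail] := Phi_tail_gt alpha1.
pose J := Num.bound (alpha / (1 - Phi t)).
have JP : alpha / (1 - Phi t) < J%:R.
  by apply: archi_boundP; rewrite divr_ge0 ?ltW.
have J0 : (0 < J)%N.
  by rewrite -(ltr0n R); apply: le_lt_trans JP; rewrite divr_ge0 ?ltW.
have t_tail : alpha / J%:R < 1 - Phi t.
  by rewrite ltr_pdivrMr ?ltr0n// mulrC -ltr_pdivrMr.
have [s s0 s_large] := mean_exp_deviation_large (M + K - c) hrho.
have [U U1 Ubound] := gaussian_union_bound (1 + M + K) hrho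
  (mulr_gt0 peak0 (divr_gt0 e0 (ltr0n R 5))).
(* Once u >= V, both [U <= u] and [x > 0] hold; once sqrt n >= B, both [J_le] and [S_small] hold. *)
pose V := U + `|1 + M + K|.
pose B := J%:R + 5 * expR (2 * s ^+ 2) / e.
near=> n.
have n1 : (1 < n)%N by near: n; exact: nbhs_infty_gt.
have n_gt0 : 0 < n%:R :> R by rewrite ltr0n ltnW.
have B0 : 0 <= B by rewrite addr_ge0// divr_ge0 ?mulr_ge0 ?expR_ge0// ltW.
have B_le : B <= Num.sqrt n%:R.
  rewrite -[leLHS]ger0_norm// -sqrtr_sqr; apply: ler_wsqrtr.
  by near: n; exact: nbhs_infty_ger.
have V_le : V ^+ 2 / 2 <= ln (normal_peak 1 * n%:R).
  rewrite -ler_expR lnK ?posrE ?mulr_gt0// -ler_pdivrMl//.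
  by near: n; exact: nbhs_infty_ger.
have V0 : 0 <= V by rewrite addr_ge0// (le_trans ler01).
(* Solves normal_peak 1 * expR (- u^2 / 2) = 1 / n, so [Phi_tail_lb] at u - 1 gives a tail of at
   least 1 / n. This exceeds 2 alpha / n because alpha < 1/2. *)
pose u : R := Num.sqrt (2 * ln (normal_peak 1 * n%:R)).
have uu : u ^+ 2 / 2 = ln (normal_peak 1 * n%:R).
  rewrite sqr_sqrtr; first by rewrite mulrC mulKf.
  by rewrite mulr_ge0// (le_trans _ V_le)// divr_ge0// sqr_ge0.
have Vu : V <= u.
  rewrite -[leLHS]ger0_norm// -sqrtr_sqr; apply: ler_wsqrtr.
  by rewrite mulrC -ler_pdivrMr.
have aV : 1 + M + K <= `|1 + M + K| := ler_norm _.
have a0 : 0 <= `|1 + M + K| := normr_ge0 _.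
have Uu : U <= u by apply: le_trans Vu; rewrite lerDl.
pose x := u - (1 + M + K).
have x0 : 0 < x by move: Vu; rewrite /x /V; lra.
have tn_tail : 2 * alpha / n%:R < 1 - Phi (u - 1).
  apply: lt_le_trans (Phi_tail_lb _); last by rewrite subr_ge0 (le_trans U1).
  rewrite subrK uu expRN lnK ?posrE ?mulr_gt0// invfM mulVKf ?gt_eqF//.
  by rewrite gtr_pMl ?invr_gt0//; lra.
have xE : u - 1 - M - K = x by rewrite /x; ring.
(* This value of [l] minimizes l^2 (1 - rho) / 2 - l x, with minimum - x^2 / (2 (1 - rho)). *)
have l0 : 0 < x / (1 - rho) by rewrite divr_gt0// subr_gt0.
have J_le : J%:R <= Num.sqrt n%:R :> R.
  apply: le_trans B_le; rewrite lerDl divr_ge0 ?mulr_ge0 ?expR_ge0//.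
  exact: ltW.
have sqrt1 : 1 <= Num.sqrt n%:R :> R by apply: le_trans J_le; rewrite ler1n.
have sqrt0 : 0 < Num.sqrt n%:R :> R by exact: lt_le_trans sqrt1.
have S_small : expR (2 * s ^+ 2) / Num.sqrt n%:R <= e / 5.
  rewrite ler_pdivrMr// -ler_pdivrMl ?divr_gt0// invf_div mulrAC.
  by apply: le_trans B_le; rewrite lerDr.
have [v v_le v_mean] := rejection_bound_mean (hmarg n) (@hcorr n) (hjoint n)
  hrho n1 K x (t - M) s (x / (1 - rho)).
have Pv : (P n (rejects n) <= v%:E)%E.
  apply: (probability_le_mean (mrejects n) v_mean) => [w|w rej].
    exact: rejection_bound_ge0.
  have /card_gt0P[i] : (0 < true_positives (fun i : 'I_n => mu i)
    (hochberg alpha (pvalues (X n) w)))%N by [].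
  rewrite inE => /andP[irej _].
  have := (rejection_bound_ge1 n1 alpha0 J0 J_le (fun i => mu_le i) c_tail
    t_tail tn_tail s0 l0 (s_large n n1) irej).
  by rewrite xE.
rewrite ger0_norm ?fine_ge0 ?measure_ge0// -lee_fin fineK; last first.
  by apply: fin_num_measure; exact: mrejects.
apply: (le_trans Pv); rewrite lee_fin; apply: (le_trans v_le).
have union_small : n%:R * expR ((x / (1 - rho)) ^+ 2 * (1 - rho) / 2 -
    x / (1 - rho) * x) <= e / 5.
  (* After multiplication by the peak, the factor normal_peak 1 * n is expR (u^2 / 2), as in
     [gaussian_union_bound]; hence the peak in the [delta] chosen for it. *)
  rewrite -(ler_pM2l peak0); apply: le_trans (Ubound u Uu).
  rewrite mulrA -[normal_peak 1 * n%:R]lnK ?posrE ?mulr_gt0//.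
  rewrite -uu -expRD ler_expR lerD2l le_eqVlt; apply/orP; left; apply/eqP.
  by rewrite /x; field; rewrite subr_eq0 gt_eqF.
have n_small : expR (2 * s ^+ 2) / n%:R <= e / 5.
  apply: le_trans S_small; rewrite ler_wpM2l ?expR_ge0// lef_pV2 ?posrE//.
  by rewrite -[leRHS](@sqr_sqrtr R n%:R) ?(ltW n_gt0)// expr2 ler_pMr.
by move: K_small t_small S_small union_small n_small; lra.
Unshelve. all: by end_near. Qed.
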